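(* For any integer $c\geq 1$ there is a graph $G$ with girth $6$, feedback vertex number at most $7$, and $\mathrm{tw}(G)\leq \mathrm{pw}(G)\leq 8$, such that $G$ has no $2$-colouring with clustering $c$.
   Context: Graphs are finite, simple and undirected. The girth of a graph is the length of its shortest cycle. The feedback vertex number of a graph $G$ is the minimum size of a set $A\subseteq V(G)$ such that $G-A$ is a forest. $\mathrm{tw}(G)$ and $\mathrm{pw}(G)$ denote the treewidth and pathwidth of $G$ (the minimum over tree-decompositions, respectively path-decompositions, of the maximum bag size minus one). A $2$-colouring assigns one of at most two colours to each vertex (not necessarily properly). A monochromatic component is a connected component of the subgraph induced by all vertices of a single colour. A colouring has clustering $c$ if every monochromatic component has at most $c$ vertices. *)

(* Defs.v *)
From HB Require Import structures.
From mathcomp Require Import all_boot.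
From mathcomp Require Import boolp.

Set Implicit Arguments.
Unset Strict Implicit.
Unset Printing Implicit Defensive.

Record sgraph := SGraph {
  vertex :> finType;
  edge : rel vertex;
  edge_sym : symmetric edge;
  edge_irrefl : irreflexive edge }.

Section Induced.
Variables (G : sgraph) (A : {set G}).

Definition induced_edge : rel {x : G | x \in A} :=
  fun x y => edge (val x) (val y).

Lemma induced_edge_sym : symmetric induced_edge.
Proof. by move=> x y; apply: edge_sym. Qed.

Lemma induced_edge_irrefl : irreflexive induced_edge.
Proof. by move=> x; apply: edge_irrefl. Qed.

Definition induced : sgraph := SGraph induced_edge_sym induced_edge_irrefl.
End Induced.

(* The bound on the size is needed: ucycle also accepts the empty sequence and
   the two ends of an edge. *)
Definition graph_cycle (G : sgraph) (s : seq G) : Prop :=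
  ucycle (@edge G) s /\ 3 <= size s.

(* A relation, because a forest has no (finite) girth. *)
Definition has_girth (G : sgraph) (g : nat) : Prop :=
  (exists2 s : seq G, graph_cycle s & size s = g) /\
  (forall s : seq G, graph_cycle s -> g <= size s).

Definition forest (G : sgraph) : Prop := forall s : seq G, ~ graph_cycle s.

Definition connected (G : sgraph) : Prop :=
  0 < #|G| /\ forall x y : G, connect (@edge G) x y.

Definition tree (G : sgraph) : Prop := connected G /\ forest G.

Definition feedback_vertex_set (G : sgraph) (A : {set G}) : Prop :=
  forest (induced (~: A)).

Definition feedback_vertex_number (G : sgraph) : nat :=
  #|[arg min_(A < [set: G] | `[< feedback_vertex_set A >]) #|A| ]|.

(* [set: G] satisfies the condition of the arg min, so that its default value
   is harmless. *)
Lemma feedback_vertex_setT (G : sgraph) : feedback_vertex_set [set: G].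
Proof.
case=> [|[x xA] s]; first by case.
by exfalso; rewrite setCT inE in xA.
Qed.

(* [T] is the indexing graph, required below to be a tree or a path. *)
Definition decomposition (G T : sgraph) (B : T -> {set G}) : Prop :=
  [/\ forall v : G, exists t : T, v \in B t,
      forall u v : G, edge u v -> exists t : T, u \in B t /\ v \in B t
    & forall v : G, connected (induced [set t : T | v \in B t])].

(* The predecessor is truncated, so the graph without vertices gets width 0
   instead of -1. *)
Definition width (G T : sgraph) (B : T -> {set G}) : nat :=
  (\max_(t : T) #|B t|).-1.

Section PathGraph.
Variable n : nat.

Definition path_edge : rel 'I_n :=
  fun i j => (i.+1 == j :> nat) || (j.+1 == i :> nat).

Lemma path_edge_sym : symmetric path_edge.
Proof. by move=> i j; rewrite /path_edge orbC. Qed.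

Lemma path_edge_irrefl : irreflexive path_edge.
Proof. by move=> i; rewrite /path_edge orbb gtn_eqF. Qed.

Definition path_graph : sgraph := SGraph path_edge_sym path_edge_irrefl.
End PathGraph.

Definition has_tree_decomposition (G : sgraph) (k : nat) : Prop :=
  exists (T : sgraph) (B : T -> {set G}),
    [/\ tree T, decomposition B & width B = k].

Definition has_path_decomposition (G : sgraph) (k : nat) : Prop :=
  exists (n : nat) (B : path_graph n.+1 -> {set G}),
    decomposition B /\ width B = k.

Lemma tree_path_graph1 : tree (path_graph 1).
Proof.
split; first by split=> [|x y]; rewrite ?card_ord // !ord1 connect0.
move=> s [/andP[_ /card_uniqP su] s3].
by have := max_card (mem s); rewrite su card_ord leqNgt (leq_trans _ s3).
Qed.

Lemma decomposition_setT (G : sgraph) :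
  decomposition (fun _ : path_graph 1 => [set: G]).
Proof.
split=> [v|u v _|v]; try by exists ord0; rewrite ?inE.
split=> [|x y].
  have h0 : (ord0 : path_graph 1) \in [set _ | v \in [set: G]] by rewrite !inE.
  by apply/card_gt0P; exists (exist _ ord0 h0).
have -> : x = y by apply: val_inj; rewrite [LHS]ord1 [RHS]ord1.
exact: connect0.
Qed.

Lemma ex_tree_decomposition (G : sgraph) :
  exists k, `[< has_tree_decomposition G k >].
Proof.
eexists; apply/asboolP; exists (path_graph 1), (fun=> [set: G]).
by split; [exact: tree_path_graph1 | exact: decomposition_setT |].
Qed.

Lemma ex_path_decomposition (G : sgraph) :
  exists k, `[< has_path_decomposition G k >].
Proof.
eexists; apply/asboolP; exists 0, (fun=> [set: G]).
by split; first exact: decomposition_setT.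
Qed.

Definition treewidth (G : sgraph) : nat := ex_minn (ex_tree_decomposition G).

Definition pathwidth (G : sgraph) : nat := ex_minn (ex_path_decomposition G).

Definition component (G : sgraph) (x : G) : {set G} :=
  [set y | connect (@edge G) x y].

Definition has_clustering (G : sgraph) (k : nat) (f : G -> 'I_k) (c : nat) :
    Prop :=
  forall (i : 'I_k) (x : induced [set v : G | f v == i]), #|component x| <= c.

(* Main.v *)
(* Take seven apices and a long path, on which every injection g from {0,..,3}
   to the apices owns a block: the r-th vertex of the block is adjacent to the
   apex g (r mod 4) only, and three vertices without apex separate it from the
   next block.  Two path vertices with the same apex are then at
   distance at least 4, and distinct apices have no common neighbour, so that
   the girth is 6; removing the apices leaves a path, and adding them to all
   the bags of the path gives width 8.  In a 2-colouring, four apices have the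
   same colour.  If their components have at most c vertices, then their block
   has at most 4c vertices of that colour, and one of its 4c + 1 consecutive
   intervals of c + 1 vertices has none of them: this interval is contained in
   a monochromatic component of the other colour. *)
Require Import Defs.
From mathcomp Require Import all_boot.
From mathcomp Require Import boolp zify.

Set Implicit Arguments.
Unset Strict Implicit.
Unset Printing Implicit Defensive.

(** * Cycles and connectivity in graphs whose vertices are ranked by integers *)

Definition consecutive : rel nat := fun i j => (i.+1 == j) || (j.+1 == i).

(* Both neighbours of the largest element would be its predecessor. *)
Lemma ucycle_consecutive (s : seq nat) : ucycle consecutive s -> size s < 3.
Proof.
case: s => [//|x0 s] us; set t := x0 :: s in us *.
have xt : \max_(i <- t) i \in t.
  rewrite /t big_cons; elim: s {us t} x0 => [|y s IH] x.
    by rewrite big_nil maxn0 inE.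
  rewrite big_cons; case: (leqP x (maxn y (\max_(j <- s) j))) => h.
    by rewrite inE IH orbT.
  by rewrite inE eqxx.
have tmax y : y \in t -> y <= \max_(i <- t) i by move=> yt; exact: leq_bigmax_seq.
move: xt tmax; set m := \max_(i <- t) i => mt tmax.
case: (rot_to mt) => i u Eu.
move: us; rewrite -(rot_ucycle i) Eu -(size_rot i t) Eu.
have {}tmax y : y \in u -> y <= m.
  by move=> yu; apply: tmax; rewrite -(mem_rot i) Eu inE yu orbT.
case: u {Eu} tmax => [//|a u]; case/lastP: u => [//|u b] tmax.
rewrite /ucycle /= rcons_path last_rcons mem_rcons inE.
have {}ha : a <= m by apply: tmax; rewrite inE eqxx.
have {}hb : b <= m by apply: tmax; rewrite inE mem_rcons inE eqxx orbT.
rewrite /consecutive inE => /andP[/andP[H1 /andP[_ H2]]].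
case/andP => _ /andP[+ _]; rewrite negb_or => /andP[ab _].
lia.
Qed.

Lemma injective_ucycle (U V : eqType) (e : rel U) (e' : rel V)
    (h : U -> V) (s : seq U) :
  injective h -> (forall x y, e x y -> e' (h x) (h y)) ->
  ucycle e s -> ucycle e' (map h s).
Proof.
move=> hI he /andP[cs us]; rewrite /ucycle map_inj_uniq // us andbT.
case: s cs {us} => [//|x s] /=; rewrite -map_rcons path_map.
by apply: sub_path => y z /he.
Qed.

Lemma forest_consecutive (G : sgraph) (h : G -> nat) :
  injective h -> (forall x y, edge x y -> consecutive (h x) (h y)) -> forest G.
Proof.
move=> hI he s [us s3].
have := ucycle_consecutive (injective_ucycle hI he us).
by rewrite size_map ltnNge s3.
Qed.

(** One climbs from the lower vertex by unit steps of [h]; injectivity identifies the vertex reached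
    at the height of the other one. *)
Lemma connected_consecutive (G : sgraph) (h : G -> nat) (x0 : G) :
  injective h ->
  (forall x y, h x < h y -> exists2 z, edge x z & h z = (h x).+1) ->
  connected G.
Proof.
move=> hI hS; split; first by apply/card_gt0P; exists x0.
have up d x y : h y = h x + d -> connect (@edge G) x y.
  elim: d x => [|d IH] x hxy; first by rewrite (hI x y) // hxy addn0.
  have [|z xz hz] := hS x y; first by rewrite hxy; lia.
  by apply: connect_trans (connect1 xz) (IH z _); rewrite hxy hz; lia.
have cS : connect_sym (@edge G) by apply: sym_connect_sym; exact: edge_sym.
move=> x y; case: (leqP (h x) (h y)) => [le|/ltnW le].
  by apply: (up (h y - h x)); rewrite subnKC.
by rewrite cS; apply: (up (h x - h y)); rewrite subnKC.
Qed.

Lemma tree_path_graph (n : nat) : tree (path_graph n.+1).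
Proof.
split; last exact: (@forest_consecutive (path_graph n.+1) val val_inj).
apply: (@connected_consecutive (path_graph n.+1) val ord0 val_inj) => x y xy.
have hx : (val x).+1 < n.+1 by apply: leq_ltn_trans xy (ltn_ord y).
by exists (Ordinal hx); rewrite //= /edge /= /path_edge eqxx.
Qed.

(** Meant for the bags that contain a given vertex: their indices form an interval. *)
Lemma connected_interval (n : nat) (S : {set path_graph n}) (t0 : path_graph n) :
  t0 \in S ->
  (forall x y z : path_graph n, x \in S -> y \in S -> x <= z <= y -> z \in S) ->
  connected (induced S).
Proof.
move=> t0S convS.
pose h (x : induced S) : nat := val (val x).
apply: (@connected_consecutive (induced S) h (exist _ t0 t0S)).
  by move=> x y /val_inj/val_inj.
move=> x y xy.
have hx : (h x).+1 < n by apply: leq_ltn_trans xy (ltn_ord (val y)).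
have zS : (Ordinal hx : path_graph n) \in S.
  by apply: (convS (val x) (val y)); rewrite ?(valP x) ?(valP y) //= leqnSn.
by exists (exist _ (Ordinal hx : path_graph n) zS);
  rewrite //= /edge /= /induced_edge /edge /= /path_edge eqxx.
Qed.

(** * Bounds on the parameters, and monochromatic connectivity *)

Lemma treewidth_leq_pathwidth (G : sgraph) : treewidth G <= pathwidth G.
Proof.
rewrite /treewidth /pathwidth; case: ex_minnP => t _ tmin.
case: ex_minnP => p /asboolP[n [B [dB wB]]] _; apply: tmin; apply/asboolP.
by exists (path_graph n.+1), B; split=> //; exact: tree_path_graph.
Qed.

Lemma pathwidth_leq (G : sgraph) (n k : nat) (B : path_graph n.+1 -> {set G}) :
  decomposition B -> (forall t, #|B t| <= k.+1) -> pathwidth G <= k.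
Proof.
move=> dB Bk; rewrite /pathwidth; case: ex_minnP => p _ pmin.
apply: (@leq_trans (width B)).
  by apply: pmin; apply/asboolP; exists n, B.
rewrite /width -[k]/k.+1.-1 -!subn1 leq_sub2r //.
by apply/bigmax_leqP => t _; exact: Bk.
Qed.

Lemma feedback_vertex_number_leq (G : sgraph) (A : {set G}) :
  feedback_vertex_set A -> feedback_vertex_number G <= #|A|.
Proof.
move=> fA; rewrite /feedback_vertex_number; case: arg_minnP => [|B _ Bmin].
  by apply/asboolP; exact: feedback_vertex_setT.
by apply: Bmin; apply/asboolP.
Qed.

Definition mono_edge (G : sgraph) (k : nat) (f : G -> 'I_k) : rel G :=
  [rel u v | edge u v && (f u == f v)].

(** Passes from components of an induced subgraph to walks in [G] itself, so that the colouring
    argument below avoids subtypes. *)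
Lemma clustering_mono (G : sgraph) (k : nat) (f : G -> 'I_k) (c : nat) (x : G) :
  has_clustering f c -> #|[set y | connect (mono_edge f) x y]| <= c.
Proof.
move=> fc; have hx : x \in [set v | f v == f x] by rewrite inE.
pose x' : induced [set v | f v == f x] := exist _ x hx.
apply: leq_trans (fc (f x) x'); rewrite -(card_imset _ val_inj).
apply/subset_leq_card/subsetP => y; rewrite inE => /connectP[p xp ->] {y}.
elim/last_ind: p xp => [_|p y IH].
  by apply/imsetP; exists x'; rewrite // inE connect0.
rewrite rcons_path last_rcons => /andP[/IH/imsetP[z + ->]] /andP[zy /eqP fzy].
have hz : f (val z) == f x by have := valP z; rewrite inE.
have hy : y \in [set v | f v == f x] by rewrite inE -fzy.
rewrite inE => xz; apply/imsetP.
exists (exist _ y hy) => //; rewrite inE.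
by apply: connect_trans xz (connect1 _).
Qed.

(** * A path with apices attached according to a labelling *)

Section ApexPath.
Variables (k n : nat) (lab : nat -> option 'I_k).

(** As [lab] is a function, a path vertex has at most one apex: distinct apices have no common
    neighbour by construction. *)
Definition apex_path_edge : rel ('I_k + 'I_n) := fun u v =>
  match u, v with
  | inl _, inl _ => false
  | inl a, inr i | inr i, inl a => lab i == Some a
  | inr i, inr j => consecutive i j
  end.

Lemma apex_path_edge_sym : symmetric apex_path_edge.
Proof. by move=> [a|i] [b|j] //=; rewrite /consecutive orbC. Qed.

Lemma apex_path_edge_irrefl : irreflexive apex_path_edge.
Proof. by move=> [a|i] //=; rewrite /consecutive orbb gtn_eqF. Qed.

Definition apex_path : sgraph := SGraph apex_path_edge_sym apex_path_edge_irrefl.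

Definition apices : {set apex_path} :=
  [set (inl a : 'I_k + 'I_n) | a in [set: 'I_k]].

Lemma mem_apices (u : apex_path) :
  (u \in apices) = (if u is inl _ then true else false).
Proof.
case: u => u; first by rewrite mem_imset ?inE // => x y [].
by apply/imsetP => -[].
Qed.

Lemma card_apices : #|apices| = k.
Proof. by rewrite card_imset ?cardsT ?card_ord // => x y []. Qed.

Lemma feedback_apices : feedback_vertex_set apices.
Proof.
(* The branch [inl] is never reached, the apices being removed, so 0 is arbitrary. *)
pose h (x : induced (~: apices)) : nat :=
  match val x : 'I_k + 'I_n with inl _ => 0 | inr i => i end.
have nl (x : induced (~: apices)) : val x \notin apices.
  by have := valP x; rewrite inE.
apply: (@forest_consecutive _ h) => x y; move: (nl x) (nl y); rewrite !mem_apices /h.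
  case Ex: (val x) => [//|i]; case Ey: (val y) => [//|j] _ _ /ord_inj ij.
  by apply: val_inj; rewrite Ex Ey ij.
rewrite /edge /= /induced_edge.
by case: (val x) (val y) => [//|i] [].
Qed.

(** Once each vertex is known to be an apex or a path vertex, adjacencies to apices become equations
    on [lab]. Two equations for one path vertex identify apices, two for one apex give a distance
    through [far'], and linear arithmetic concludes. *)
Ltac close_short_cycle sumE ordE far' :=
  rewrite /consecutive ?andbF ?sumE ?ordE //= ?andbT;
  repeat match goal with
  | |- is_true (_ && _) -> _ => move=> /andP[]
  | |- is_true (lab _ == Some _) -> _ => move=> /eqP ?
  | |- is_true _ -> _ => move=> ?
  end;
  repeat match goal with
  | H : lab ?i = Some ?a, H' : lab ?i = Some ?b |- _ =>
     assert_fails (constr_eq a b); move: (H'); rewrite H => -[?]; subst; clear H'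
  end;
  try match goal with H : is_true (?a != ?a) |- _ => by rewrite eqxx in H end;
  repeat match goal with
  | H : lab ?i = Some ?a, H' : lab ?j = Some ?a |- _ =>
     have := far' _ _ _ H H'; clear H
  end;
  lia.

(** Two apices on a cycle of length at most 5 would be adjacent or have a common neighbour. A single
    apex would have two neighbours joined by at most three path edges, against the spacing of 4.
    Without apex, the cycle would lie in a path. *)
Lemma apex_path_girth :
  (forall i j a, lab i = Some a -> lab j = Some a -> i < j -> i + 4 <= j) ->
  forall s : seq apex_path, graph_cycle s -> 6 <= size s.
Proof.
move=> far.
have far' i j a : lab i = Some a -> lab j = Some a ->
    [|| i == j, i + 4 <= j | j + 4 <= i].
  by move=> hi hj; have := far _ _ _ hi hj; have := far _ _ _ hj hi; lia.
have ordE (i j : 'I_n) : (i == j) = (i == j :> nat) by [].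
have sumE := (@inj_eq _ _ _ (@inl_inj 'I_k 'I_n),
              @inj_eq _ _ _ (@inr_inj 'I_k 'I_n)).
move=> s [us s3]; rewrite leqNgt; apply/negP => s6; move: us s3 s6.
case: s => [|u0 [|u1 [|u2 [|u3 [|u4 [|u5 s]]]]]] //.
all: rewrite /ucycle /= /edge /= ?inE ?negb_or => + _ _.
- by move: u0 u1 u2 => [x0|x0] [x1|x1] [x2|x2] /=;
     close_short_cycle sumE ordE far'.
- by move: u0 u1 u2 u3 => [x0|x0] [x1|x1] [x2|x2] [x3|x3] /=;
     close_short_cycle sumE ordE far'.
- by move: u0 u1 u2 u3 u4 => [x0|x0] [x1|x1] [x2|x2] [x3|x3] [x4|x4] /=;
     close_short_cycle sumE ordE far'.
Qed.

(** Two path vertices at the least distance allowed, 4, close a 6-cycle through their common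
    apex. *)
Lemma apex_path_has_girth (i : nat) (a : 'I_k) :
  (forall i j a, lab i = Some a -> lab j = Some a -> i < j -> i + 4 <= j) ->
  i + 4 < n -> lab i = Some a -> lab (i + 4) = Some a -> has_girth apex_path 6.
Proof.
move=> far in4 hi hi4; split; last exact: apex_path_girth.
have lt d : d < 5 -> i + d < n by lia.
pose v d (h : d < 5) : apex_path := inr (Ordinal (lt d h)).
exists [:: inl a; v 0 isT; v 1 isT; v 2 isT; v 3 isT; v 4 isT] => //; split=> //.
have inrE (x y : 'I_n) : ((inr x : 'I_k + 'I_n) == inr y) = (x == y :> nat).
  exact: (inj_eq inr_inj).
rewrite /ucycle /= /edge /= !inE !inrE /= addn0 hi hi4 !eqxx /consecutive /=.
lia.
Qed.

Lemma apex_path_no_clustering (m c q : nat) (col : 'I_2) (g : 'I_m -> 'I_k)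
    (l : 'I_((m * c).+1 * c.+1) -> 'I_m) (f : apex_path -> 'I_2) :
  q + (m * c).+1 * c.+1 <= n ->
  (forall r : 'I_((m * c).+1 * c.+1), lab (q + r) = Some (g (l r))) ->
  (forall j, f (inl (g j)) = col) -> ~ has_clustering f c.
Proof.
move=> qn labE fg fc.
have pP (r : 'I_((m * c).+1 * c.+1)) : q + r < n.
  by apply: leq_trans qn; rewrite ltn_add2l.
pose p r : apex_path := inr (Ordinal (pP r)).
have pI : injective p by move=> r s; rewrite /p => -[] /addnI /ord_inj.
pose R := [set r | f (p r) == col].
(* Grouped by [l], the vertices of [R] are neighbours of [m] apices of their own colour, whose
   components have at most [c] vertices each. *)
have Rle : #|R| <= m * c.
  rewrite -sum1_card (partition_big l xpredT) //=.
  apply: (@leq_trans (\sum_(j < m) c)); last by rewrite sum_nat_const card_ord.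
  apply: leq_sum => j _.
  apply: leq_trans (clustering_mono (inl (g j) : apex_path) fc).
  rewrite sum1_card -(card_imset _ pI); apply/subset_leq_card/subsetP => y.
  case/imsetP => r; rewrite unfold_in /= inE => /andP[/eqP fr /eqP lr] ->.
  rewrite inE; apply: connect1.
  by rewrite /mono_edge /= /edge /= labE lr fg fr !eqxx.
(* If the [b]-th interval of [c + 1] vertices missed [R], all of it would have the only other
   colour, a monochromatic path that is too long. *)
have Rge (b : 'I_(m * c).+1) : exists r, (r \in R) && (r %/ c.+1 == b).
  apply/existsP; apply: contraT; rewrite negb_exists => /forallP nR.
  have sP (i : 'I_c.+1) : b * c.+1 + i < (m * c).+1 * c.+1.
    have /leP := ltn_ord b; have := ltn_ord i; nia.
  pose s i := Ordinal (sP i).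
  have fs i : f (p (s i)) != col.
    have := nR (s i); rewrite inE /= divnMDl // divn_small // addn0 eqxx andbT.
    exact.
  have fss i j : f (p (s i)) = f (p (s j)).
    have two (x y z : 'I_2) : x != z -> y != z -> x = y.
      by move: x y z; do 3![case=> [[|[|?]] ?] //]; move=> *; exact: ord_inj.
    exact: two (fs i) (fs j).
  have := clustering_mono (p (s ord0)) fc; rewrite leqNgt => /negP; case.
  have psI : injective (p \o s).
    by move=> i j /pI[] /addnI /ord_inj.
  rewrite -[X in X <= _]card_ord -cardsT -(card_imset _ psI).
  apply/subset_leq_card/subsetP => y /imsetP[[i ic] _ ->] {y}; rewrite inE /=.
  elim: i ic => [|i IH] ic.
    by rewrite (_ : Ordinal ic = ord0) ?connect0 //; exact: ord_inj.
  apply: connect_trans (IH (ltnW ic)) (connect1 _).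
  rewrite /mono_edge /= /edge /= /consecutive /= -!addnS eqxx.
  by rewrite (fss _ (Ordinal ic)) eqxx.
(* One element of [R] is chosen per interval; its quotient by [c.+1] recovers the interval, so the
   choices are distinct. *)
have [h hP] := fin_all_exists Rge.
have hI : injective h.
  move=> b b' e; have /andP[_ /eqP e1] := hP b; have /andP[_ /eqP e2] := hP b'.
  by apply: ord_inj; rewrite -e1 -e2 e.
suff: (m * c).+1 <= #|R| by rewrite ltnNge Rle.
rewrite -[X in X <= _]card_ord -cardsT -(card_imset _ hI).
by apply/subset_leq_card/subsetP => r /imsetP[b _ ->]; have /andP[] := hP b.
Qed.

End ApexPath.

Lemma pathwidth_apex_path (k n : nat) (lab : nat -> option 'I_k) :
  pathwidth (apex_path n.+1 lab) <= k.+1.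
Proof.
pose G := apex_path n.+1 lab.
pose P (t : nat) := [set (inr i : 'I_k + 'I_n.+1) |
                     i in [set i : 'I_n.+1 | t <= i <= t.+1]].
pose B (t : path_graph n.+1) : {set G} := apices n.+1 lab :|: P t.
have mP (t : nat) (i : 'I_n.+1) : (inr i \in P t) = (t <= i <= t.+1).
  by rewrite mem_imset ?inE //; exact: inr_inj.
have Br (t : path_graph n.+1) (i : 'I_n.+1) :
    ((inr i : G) \in B t) = (t <= i <= t.+1).
  by rewrite in_setU mem_apices mP.
have Bl (t : path_graph n.+1) (a : 'I_k) : (inl a : G) \in B t.
  by rewrite in_setU mem_apices.
apply: (@pathwidth_leq _ n _ B).
  split=> [[a|i]|[a|i] [b|j]|[a|i]].
  - by exists ord0.
  - by exists i; rewrite Br leqnn leqnSn.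
  - by [].
  - by exists j; rewrite Bl Br leqnn leqnSn.
  - by exists i; rewrite Bl Br leqnn leqnSn.
  - rewrite /edge /= /consecutive => /orP[/eqP ij|/eqP ij].
      by exists i; rewrite !Br -ij; split; lia.
    by exists j; rewrite !Br -ij; split; lia.
  - by apply: (@connected_interval _ _ ord0) => [|x y z _ _ _]; rewrite inE Bl.
  - have mS (t : path_graph n.+1) :
      (t \in [set t' | (inr i : G) \in B t']) = (t <= i <= t.+1) by rewrite inE Br.
    by apply: (@connected_interval _ _ i) => [|x y z]; rewrite !mS; lia.
move=> t; apply: leq_trans (_ : k + 2 <= _); last by rewrite addn2.
apply: leq_trans (leq_card_setU _ _).1 _; rewrite card_apices leq_add2l.
rewrite card_imset; last exact: inr_inj.
(* In the last bag [t.+1] is out of range and [inord] returns 0, which is harmless for an upper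
   bound. *)
apply: leq_trans (_ : #|[set (t : 'I_n.+1); inord t.+1]| <= 2); last first.
  by rewrite cards2; case: eqP.
apply/subset_leq_card/subsetP => i; rewrite !inE => /andP[ti it].
move: ti; rewrite leq_eqVlt => /orP[/eqP ti|ti].
  by apply/orP; left; apply/eqP/ord_inj.
apply/orP; right; apply/eqP/ord_inj; rewrite inordK; first lia.
by have := ltn_ord i; lia.
Qed.

(** * The periodic labelling by blocks *)

Section Blocks.
Variables (L : nat) (g : nat -> 'I_4 -> 'I_7).

(** The argument of [inord] is below 4, so its default value never occurs. *)
Definition block_label (i : nat) : option 'I_7 :=
  let r := i %% (L + 3) in
  if r < L then Some (g (i %/ (L + 3)) (inord (r %% 4))) else None.

Lemma block_label_at (q r : nat) :
  r < L -> block_label (q * (L + 3) + r) = Some (g q (inord (r %% 4))).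
Proof.
move=> rL; have rM : r < L + 3 by rewrite ltn_addr.
rewrite /block_label modnMDl divnMDl ?addn_gt0 ?orbT //.
by rewrite modn_small // divn_small // addn0 rL.
Qed.

(** Inside a block, injectivity of [g q] turns equal labels into positions congruent modulo 4;
    between blocks, the three unlabelled vertices give the distance. *)
Lemma block_label_far :
  (forall q, injective (g q)) ->
  forall i j a, block_label i = Some a -> block_label j = Some a -> i < j ->
  i + 4 <= j.
Proof.
move=> gI i j a; rewrite /block_label.
case: ifP => // ri [ei]; case: ifP => // rj [ej] ij.
rewrite leqNgt; apply/negP => ji.
have M0 : 0 < L + 3 by lia.
have qE : i %/ (L + 3) = j %/ (L + 3).
  have := divn_eq i (L + 3); have := divn_eq j (L + 3).
  have := leq_div2r (L + 3) (ltnW ij).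
  (* Otherwise i lies in the unlabelled end of its block. *)
  move: (i %/ _) (j %/ _) => a1 b1 le e1 e2; nia.
move: ei; rewrite -ej qE => /gI/(congr1 (@nat_of_ord 4)).
rewrite !inordK ?ltn_mod // => r4.
have := divn_eq i (L + 3); have := divn_eq j (L + 3); rewrite qE.
lia.
Qed.
End Blocks.

(** * Choice of the block, and conclusion *)

Lemma four_of_seven (f : 'I_7 -> 'I_2) :
  exists (col : 'I_2) (g : {ffun 'I_4 -> 'I_7}),
    injective g /\ forall j, f (g j) = col.
Proof.
have [col colP] : exists col, 4 <= #|[set a | f a == col]|.
  (* Two colour classes of at most three elements would cover only six of the seven. *)
  apply/existsP; apply: contraT; rewrite negb_exists => /forallP H.
  have : #|'I_7| = \sum_(col < 2) #|[set a | f a == col]|.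
    rewrite -sum1_card (partition_big f xpredT) //=.
    by apply: eq_bigr => col _; rewrite sum1dep_card.
  rewrite card_ord !big_ord_recl big_ord0 => E.
  by move: (H ord0) (H (lift ord0 ord0)); rewrite -!ltnNge; move: E; lia.
(* A finite function, so that it can be looked up in an enumeration of the injections. *)
pose g := [ffun j => enum_val (widen_ord colP j)].
exists col, g; split=> [i j|j]; rewrite /g !ffunE.
  by move=> /enum_val_inj e; apply: ord_inj; exact: (congr1 (@nat_of_ord _) e).
by have := enum_valP (widen_ord colP j); rewrite inE => /eqP.
Qed.

Theorem proposition16 (c : nat) (hc : 1 <= c) :
  exists G : sgraph,
    [/\ has_girth G 6,
        feedback_vertex_number G <= 7,
        treewidth G <= pathwidth G <= 8
      & ~ exists f : G -> 'I_2, has_clustering f c].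
Proof.
(* The block length in [apex_path_no_clustering] for four apices. *)
pose L := (4 * c).+1 * c.+1.
(* Positions 0 and 4 of the first block must both be labelled, for the 6-cycle. *)
have L5 : 5 <= L by rewrite /L; nia.
(* This default of [nth] is itself injective, so that [g q] is injective for [q] beyond the list
   too. *)
pose g0 : {ffun 'I_4 -> 'I_7} := [ffun j => widen_ord (isT : 4 <= 7) j].
pose s := enum [pred g : {ffun 'I_4 -> 'I_7} | injectiveb g].
pose g q := nth g0 s q.
have gI q : injective (g q).
  apply/injectiveP; have [qs|qs] := ltnP q (size s).
    by have := mem_nth g0 qs; rewrite mem_enum.
  rewrite /g nth_default //; apply/injectiveP => i j.
  rewrite !ffunE => e.
  by apply: ord_inj; exact: (congr1 (@nat_of_ord _) e).
pose lab := block_label L (fun q => g q).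
(* The extra block yields [L + 3 <= n] without a proof that [s] is nonempty. *)
pose n := (size s).+1 * (L + 3).
exists (apex_path n.+1 lab); split.
- apply: (@apex_path_has_girth _ _ _ 0 (g 0 ord0)).
  + exact: block_label_far gI.
  + have LM : L + 3 <= n by rewrite leq_pmull.
    by lia.
  + rewrite -[0]/(0 * (L + 3) + 0) /lab block_label_at.
      by congr (Some (g _ _)); apply: ord_inj; rewrite inordK.
    by rewrite (leq_trans _ L5).
  + rewrite -[0 + 4]/(0 * (L + 3) + 4) /lab block_label_at.
      by congr (Some (g _ _)); apply: ord_inj; rewrite inordK.
    by rewrite (leq_trans _ L5).
- rewrite (leq_trans (feedback_vertex_number_leq (@feedback_apices _ n.+1 lab))) //.
  by rewrite card_apices.
- by rewrite treewidth_leq_pathwidth pathwidth_apex_path.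
case=> f fc; have [col [h [hI hcol]]] := four_of_seven (fun a => f (inl a)).
have hs : h \in s by rewrite mem_enum; apply/injectiveP.
(* The block owned by [h] is the one numbered by the index of [h] in [s]. *)
have hq : g (index h s) = h by rewrite /g nth_index.
apply: (@apex_path_no_clustering _ _ _ 4 c (index h s * (L + 3)) col h
         (fun r => inord (r %% 4)) f) fc => //.
  rewrite -/L /n; have : index h s < size s by rewrite index_mem.
  nia.
by move=> r; rewrite /lab block_label_at ?hq.
Qed.
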